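(* For every integer $d\ge 1$ and every rotor mechanism on $\mathbb{Z}^d$, there exists a recurrent rotor configuration on $\mathbb{Z}^d$.
   Context: $\mathbb{Z}^d$ denotes the graph with vertex set $\mathbb{Z}^d$ and an (undirected) edge between each pair of vertices at Euclidean distance $1$. A rotor mechanism on a graph assigns to each vertex a fixed cyclic order of its neighbours (a single cycle through all neighbours). A rotor configuration assigns to each vertex one of its neighbours (the vertex its rotor points to). Given a rotor mechanism, an initial rotor configuration and a starting vertex for a particle, the rotor walk evolves in discrete time: at each step the rotor at the particle's current location is first incremented to point to the next neighbour in the cyclic order, and then the particle moves to this new neighbour. The rotor walk is recurrent if it visits every vertex infinitely many times. A rotor configuration is called recurrent if the rotor walk with it as initial configuration is recurrent for every starting vertex (on an infinite connected graph with all degrees finite, this is equivalent to recurrence for some starting vertex). *)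

(* Defs.v *)
From mathcomp Require Import all_boot all_order all_algebra.
Set Implicit Arguments.
Unset Strict Implicit.
Unset Printing Implicit Defensive.
Import GRing.Theory Num.Theory.
Local Open Scope ring_scope.

(* Adjacency in the lattice Z^d: the squared Euclidean distance, which is an
   integer, equals 1 exactly when the Euclidean distance does. *)
Definition Zd_adj (d : nat) : rel 'rV[int]_d :=
  fun x y => \sum_(i < d) (x ord0 i - y ord0 i) ^+ 2 == 1.

(* A cyclic order on the neighbours of v is given by a duplicate-free list m v
   of exactly these neighbours, read cyclically: [next (m v) u] is the
   successor of u.  Lists differing by a rotation give the same cyclic order. *)
Definition rotor_mechanism (V : eqType) (adj : rel V) (m : V -> seq V) : Prop :=
  forall v, uniq (m v) /\ m v =i adj v.

Definition rotor_config (V : eqType) (adj : rel V) (r : V -> V) : Prop :=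
  forall v, adj v (r v).

(* A state is the current rotor configuration with the particle's location. *)
Definition rotor_step (V : eqType) (m : V -> seq V) (s : (V -> V) * V) :
    (V -> V) * V :=
  let: (r, x) := s in
  let y := next (m x) (r x) in
  (fun v => if v == x then y else r v, y).

Definition rotor_walk (V : eqType) (m : V -> seq V) (r : V -> V) (x : V)
    (n : nat) : V :=
  (iter n (rotor_step m) (r, x)).2.

Definition recurrent_walk (V : eqType) (w : nat -> V) : Prop :=
  forall v (N : nat), exists n : nat, (N <= n)%N /\ w n = v.

Definition recurrent_config (V : eqType) (m : V -> seq V) (r : V -> V) : Prop :=
  forall x, recurrent_walk (rotor_walk m r x).

(* Main.v *)
Require Import Defs.
From mathcomp Require Import all_boot all_order all_algebra.
From mathcomp Require Import zify.
From Stdlib Require Classical_Prop.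

(* Let each rotor be set so that its first move goes to the neighbour of smaller
   sup norm whenever there is one.  A vertex outside a box B = {|x| <= K} has at
   most one neighbour in B, and if it has one, it is the vertex to which the
   first particle is sent: as long as its neighbour in B has sent it only one
   particle, it just reflects it.
   Stop the walk at any time T and take a box B containing everything visited
   so far.  The firing vector equal to the degree on B, to 1 on the vertices
   adjacent to B and to 0 elsewhere gives no vertex more particles than it may
   emit, so the continued walk first exceeds it at its starting point w_T, and
   just before doing so the vertices whose rotors (at time T) lead to w_T have
   emitted exactly their degree.  Rotors of visited vertices are last exits,
   hence they all lead to w_T: every neighbour of a vertex visited before T is
   visited again after T.  As T is arbitrary, connectivity gives recurrence. *)

Set Implicit Arguments.
Unset Strict Implicit.
Unset Printing Implicit Defensive.

(** * Visit counts and conservation of particles for a rotor walk *)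

Section RotorWalk.

Variables (V : eqType) (adj : rel V) (m : V -> seq V).
Hypotheses (adjC : symmetric adj) (hm : rotor_mechanism adj m).

Lemma mem_rotor_mechanismC u v : (u \in m v) = (v \in m u).
Proof. by rewrite (hm v).2 (hm u).2 -!topredE /= adjC. Qed.

Section Counting.

Variables (r : V -> V) (x : V).
Hypothesis hr : rotor_config adj r.

Let w := rotor_walk m r x.

Definition visits (n : nat) (v : V) : nat := \sum_(s < n) (w s == v).

(** Exits from [u] to [v] among its first [k], for any [k], so that firing vectors can be compared
    with walks. A rotor turns before the particle moves, hence the start at the successor of
    [r u]. *)
Definition uses (u v : V) (k : nat) : nat :=
  count_mem v (traject (next (m u)) (next (m u) (r u)) k).

Lemma visitsS n v : visits n.+1 v = visits n v + (w n == v).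
Proof. by rewrite /visits big_ord_recr. Qed.

Lemma leq_visits v : {homo visits ^~ v : n p / n <= p}.
Proof.
apply: homo_leq => [//|y z t|n]; first exact: leq_trans.
by rewrite visitsS leq_addr.
Qed.

Lemma usesS u v k :
  uses u v k.+1 = uses u v k + (iter k (next (m u)) (next (m u) (r u)) == v).
Proof. by rewrite /uses trajectSr -cats1 count_cat /= addn0. Qed.

Lemma leq_uses u v : {homo uses u v : n p / n <= p}.
Proof.
apply: homo_leq => [//|y z t|n]; first exact: leq_trans.
by rewrite usesS leq_addr.
Qed.

Lemma mem_rotor v : r v \in m v.
Proof. by rewrite (hm v).2; exact: hr. Qed.

Lemma rotor_iter n v :
  (iter n (rotor_step m) (r, x)).1 v = iter (visits n v) (next (m v)) (r v).
Proof.
elim: n => [|n IH]; first by rewrite /visits big_ord0.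
rewrite visitsS iterS; have -> : w n = (iter n (rotor_step m) (r, x)).2 by [].
case: (iter n _ _) IH => [rho y] /= IH.
rewrite eq_sym; case: eqP => [->|_]; last by rewrite addn0.
by rewrite addn1 iterS -IH.
Qed.

Lemma walkS n :
  w n.+1 = iter (visits n (w n)) (next (m (w n))) (next (m (w n)) (r (w n))).
Proof.
rewrite -iterSr iterS -rotor_iter /w /rotor_walk iterS.
by case: (iter n _ _).
Qed.

Lemma rotor_config_iter n : rotor_config adj (iter n (rotor_step m) (r, x)).1.
Proof.
move=> v; rewrite -[adj v _]/(_ \in adj v) -(hm v).2 rotor_iter.
by elim: (visits n v) => [|k IH]; rewrite ?mem_rotor //= mem_next.
Qed.

Lemma walkS_mem n : w n.+1 \in m (w n).
Proof.
rewrite walkS -iterSr.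
by elim: _.+1 => [|k IH]; rewrite ?mem_rotor //= mem_next.
Qed.

Lemma perm_traject_rotor u :
  perm_eq (traject (next (m u)) (next (m u) (r u)) (size (m u))) (m u)
  /\ iter (size (m u)) (next (m u)) (r u) = r u.
Proof.
have [i s Es] := rot_to (mem_rotor u); have um := (hm u).1.
have := cycle_next um; rewrite -(rot_cycle i) Es /= => /fpathP[n En].
have sz : n = size (m u).
  move/(congr1 size): En; rewrite size_rcons size_traject => <-.
  by rewrite -(size_rot i (m u)) Es.
split; first by rewrite -sz -En perm_rcons -Es perm_rot.
rewrite -sz; case: n En {sz} => [|n]; first by case: (s).
by rewrite trajectSr => /rcons_inj[_ Er]; rewrite iterSr -Er.
Qed.

Lemma uses_size u v : uses u v (size (m u)) = (v \in m u).
Proof.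
have [/permP Hp _] := perm_traject_rotor u.
by rewrite /uses Hp count_uniq_mem // (hm u).1.
Qed.

Lemma uses_muln u v q : uses u v (q * size (m u)) = q * (v \in m u).
Proof.
have [_ Hi] := perm_traject_rotor u.
elim: q => [|q IH] //; rewrite !mulSn -IH -uses_size /uses.
by rewrite trajectD count_cat -iterSr iterS Hi.
Qed.

(** Conservation: the stays at [v] up to and including time [n] are the start plus the entries from
    its neighbours. *)
Lemma visits_flow n v :
  visits n v + (w n == v) = (x == v) + \sum_(u <- m v) uses u v (visits n u).
Proof.
elim: n => [|n IH].
  rewrite /visits big_ord0 addnC big1 // => u _.
  by rewrite big_ord0.
rewrite visitsS IH -addnA; congr (_ + _).
transitivity (\sum_(u <- m v) (uses u v (visits n u)
   + (w n == u) * (w n.+1 == v))).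
  rewrite big_split /= -big_distrl /=; congr (_ + _).
  have -> : \sum_(u <- m v) (w n == u) = (w n \in m v).
    rewrite -(count_uniq_mem _ (hm v).1) -sum1_count [RHS]big_mkcond /=.
    by apply: eq_bigr => u _; rewrite eq_sym; case: (u == _).
  rewrite mem_rotor_mechanismC; case: eqP => [<-|_]; last by rewrite muln0.
  by rewrite walkS_mem.
apply: eq_bigr => u _; rewrite visitsS.
case: eqP => [<-|_]; last by rewrite /= !addn0.
by rewrite addn1 usesS -walkS mul1n.
Qed.

Lemma visits_gt0P n v : reflect (exists2 s, s < n & w s = v) (0 < visits n v).
Proof.
apply: (iffP idP) => [|[s sn <-]].
  elim: n => [|n IH]; first by rewrite /visits big_ord0.
  rewrite visitsS addn_gt0 => /orP[/IH[s sn ws]|].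
    by exists s; rewrite // ltnS ltnW.
  by case: eqP => // <- _; exists n.
by apply: leq_trans (leq_visits _ sn); rewrite visitsS eqxx addn1.
Qed.

Lemma visits_neighbour_bounded u v C :
  u \in m v -> (forall n, visits n u <= C) ->
  exists C', forall n, visits n v <= C'.
Proof.
(* Each full turn of [v] sends one particle to [u], so [C.+2] turns would exceed the at most [C.+1]
   entries into [u]. *)
move=> uv hC; exists (C.+2 * size (m v)) => n; rewrite leqNgt; apply/negP => lt.
have := leq_uses v u (ltnW lt); rewrite uses_muln uv muln1.
move: (uv); rewrite mem_rotor_mechanismC => vu.
have := visits_flow n u; rewrite (big_rem v vu) /=.
have := hC n; case: (w n == u); case: (x == u) => /=; lia.
Qed.

(* [c] is a firing vector under which no vertex receives more particles than
   it may emit, so the first vertex to exceed it must be the start. *)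
Lemma first_excess (c : V -> nat) :
    (forall v, \sum_(u <- m v) uses u v (c u) <= c v) ->
    (exists n v, c v < visits n v) ->
  exists n, [/\ forall v, visits n v <= c v, w n = x & visits n x = c x].
Proof.
move=> hc hex.
have hex' : exists n, c (w n) <= visits n (w n).
  case: hex => n [v]; elim: n => [|n IH]; first by rewrite /visits big_ord0.
  rewrite visitsS; case: eqP => [<-|_]; last by rewrite addn0.
  by rewrite addn1 ltnS; exists n.
case: (ex_minnP hex') => n hn hmin; exists n.
have le v : visits n v <= c v.
  have : forall j, j <= n -> visits j v <= c v.
    elim=> [|j IH] jn; first by rewrite /visits big_ord0.
    rewrite visitsS; case: eqP => [E|_]; last by rewrite addn0 IH // ltnW.
    rewrite addn1 -E ltnNge; apply/negP => /hmin.
    by rewrite leqNgt jn.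
  exact.
have Nx : w n = x.
  apply/eqP/negPn/negP => ne.
  have := visits_flow n (w n); rewrite eqxx eq_sym (negPf ne) add0n addn1 => E.
  have := hc (w n); rewrite leqNgt => /negP; apply.
  by rewrite (leq_ltn_trans hn) // E; apply: leq_sum => u _; exact: leq_uses.
by split=> //; apply/eqP; rewrite eqn_leq le; move: hn; rewrite Nx.
Qed.

(** With the particle back at its start, [v] has received exactly [c v] particles, so every
    inequality in its inflow is tight. The last exit allowed to [u] leads to [v]; without it the
    inflow would fall short. *)
Lemma saturation_back (c : V -> nat) n u v k :
    (forall v, \sum_(u <- m v) uses u v (c u) <= c v) ->
    (forall v, visits n v <= c v) -> w n = x ->
    visits n v = c v -> u \in m v ->
    c u = k.+1 -> iter k.+1 (next (m u)) (r u) = v ->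
  visits n u = c u.
Proof.
move=> hc le wn Nv uv cu last.
have := visits_flow n v; rewrite wn addnC => /addnI; rewrite Nv => E.
apply/eqP; rewrite eqn_leq le leqNgt; apply/negP => lt.
have := hc v; rewrite E leqNgt => /negP; apply.
rewrite !(big_rem u uv) /= -addSn leq_add //; last first.
  by apply: leq_sum => z _; exact: leq_uses.
rewrite cu usesS -iterSr last eqxx addn1 ltnS.
by apply: leq_uses; rewrite -ltnS -cu.
Qed.

Inductive rotor_path (B : pred V) (rho : V -> V) (y : V) : V -> Prop :=
| rotor_path0 : rotor_path B rho y y
| rotor_pathS v : v \in B -> rotor_path B rho y (rho v) ->
    rotor_path B rho y v.

(* The current rotor of a visited vertex is its last exit. *)
Lemma visited_rotor_path (B : pred V) n :
    (forall s, s < n -> w s \in B) ->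
  forall s, s <= n ->
  rotor_path B (iter n (rotor_step m) (r, x)).1 (w n) (w s).
Proof.
elim: n => [|n IH] hB s; first by rewrite leqn0 => /eqP->; left.
rewrite leq_eqVlt => /orP[/eqP->|]; first by left.
move/IH=> /(_ (fun s h => hB s (ltnW h))).
have hn := hB n (ltnSn n); move: hn; rewrite /w /rotor_walk iterS.
case: (iter n _ _) => rho y /= hy.
elim=> [|v vB _ IHv]; first by right; rewrite //= eqxx; left.
case: (eqVneq v y) => [->|ne]; first by right; rewrite //= eqxx; left.
by right; rewrite //= (negPf ne).
Qed.

End Counting.

Lemma rotor_walkD r x n k :
  rotor_walk m r x (n + k) =
  rotor_walk m (iter n (rotor_step m) (r, x)).1 (rotor_walk m r x n) k.
Proof. by rewrite /rotor_walk addnC iterD; case: (iter n _ _). Qed.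


(** * Returning to visited vertices by reflection outside a box *)

Lemma tour (B : pred V) r x :
    rotor_config adj r -> x \in B ->
    (forall u b, u \notin B -> b \in B -> b \in m u ->
      next (m u) (r u) = b) ->
    (exists n, rotor_walk m r x n \notin B /\
      forall b, b \in m (rotor_walk m r x n) -> b \notin B) ->
  exists n, forall v, rotor_path B r x v ->
    visits r x n v = size (m v) /\
    forall u, u \in m v -> exists k, rotor_walk m r x k = u.
Proof.
move=> hr xB reflect [ne [neB nenB]].
pose c v := if v \in B then size (m v) else count (mem B) (m v).
have c_out v : v \notin B -> c v <= 1.
  rewrite /c => vB; rewrite (negPf vB).
  case: (boolP (has (mem B) (m v))) => [/hasP[b bv bB]|]; last first.
    by rewrite has_count -leqNgt leqn0 => /eqP->.
  rewrite (@eq_in_count _ _ (pred1 b)) => [|z zv /=].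
    by rewrite count_uniq_mem ?(hm v).1 ?leq_b1.
  apply/idP/eqP => [zB|->//].
  by rewrite -(reflect v z) // -(reflect v b).
(* The only exit allowed outside [B] goes into [B], so a vertex outside [B] receives only from [B],
   at most one particle per neighbour. *)
have c_reflect u v : u \notin B -> uses r u v (c u) <= (v \in B).
  move=> uB; have := c_out u uB; rewrite leq_eqVlt ltnS leqn0.
  case/orP=> /eqP cu; rewrite cu /uses //= addn0.
  move: cu; rewrite /c (negPf uB) => cu.
  have /hasP[b bu bB] : has (mem B) (m u) by rewrite has_count cu.
  rewrite (reflect u b uB bB bu); case: eqP => [<-|//].
  by rewrite (_ : b \in B).
have c_le1 u v : uses r u v (c u) <= 1.
  case: (boolP (u \in B)) => uB; last first.
    exact: leq_trans (c_reflect _ _ uB) (leq_b1 _).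
  by rewrite /c uB uses_size // leq_b1.
have hc v : \sum_(u <- m v) uses r u v (c u) <= c v.
  case: (boolP (v \in B)) => vB.
    rewrite {2}/c vB -sum1_size; exact: leq_sum.
  rewrite {2}/c (negPf vB) -sum1_count [leqRHS]big_mkcond /=.
  apply: leq_sum => u _; case: ifP => // /negP/negP uB.
  by rewrite (leq_trans (c_reflect _ _ uB)) // (negPf vB).
have [|n [le wn Nx]] := first_excess (x := x) hr hc.
  (* With no neighbour in [B], this vertex has [c] equal to 0, so a single visit exceeds it. *)
  exists ne.+1, (rotor_walk m r x ne).
  rewrite visitsS eqxx addn1 /c (negPf neB).
  rewrite [count _ _](_ : _ = 0) //.
  apply/eqP; rewrite -leqn0 leqNgt -has_count.
  by apply/hasPn => b /nenB.
exists n => v pv.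
suff [vB Nv] : v \in B /\ visits r x n v = c v.
  split=> [|u uv]; first by rewrite Nv /c vB.
  move: (uv); rewrite mem_rotor_mechanismC => vu.
  have := visits_flow x hr n u; rewrite (big_rem v vu) /=.
  rewrite Nv {1}/c vB uses_size // uv => E.
  case: (eqVneq (rotor_walk m r x n) u) => [<-|ne']; first by exists n.
  have /visits_gt0P[k _ <-] : 0 < visits r x n u.
    by move: E; rewrite (negPf ne'); lia.
  by exists k.
elim: pv => [//|{}v vB _ [rB Nr]]; split=> //.
(* A full turn ends with the rotor back at [r v], so the last of the [c v] exits leads to the next
   vertex of the path. *)
have [_ Hi] := perm_traject_rotor hr v.
have rv := mem_rotor hr v.
have sz : size (m v) = (size (m v)).-1.+1 by case: (m v) rv.
apply: (saturation_back hr hc le wn Nr (k := (size (m v)).-1)).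
- by rewrite -mem_rotor_mechanismC.
- by rewrite /c vB.
- by rewrite -sz.
Qed.

Lemma revisit_neighbours (h : V -> nat) r x :
    rotor_config adj r ->
    (forall u v, adj u v -> h v <= (h u).+1) ->
    (forall u b, adj u b -> h b < h u -> next (m u) (r u) = b) ->
    (forall rho y k, rotor_config adj rho ->
      exists n, k < h (rotor_walk m rho y n)) ->
  forall s u N, u \in m (rotor_walk m r x s) ->
  exists n, N <= n /\ rotor_walk m r x n = u.
Proof.
move=> hr hstep reflect hexit s u N uv.
pose T := maxn s N; pose K := \max_(t < T.+1) h (rotor_walk m r x t).
pose B := [pred v | h v <= K].
have wB t : t <= T -> rotor_walk m r x t \in B.
  by move=> tT; rewrite inE (leq_bigmax (Ordinal (tT : t < T.+1))).
set rho := (iter T (rotor_step m) (r, x)).1.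
have hrho : rotor_config adj rho by exact: rotor_config_iter.
have [||n tour_n] := @tour B rho (rotor_walk m r x T) hrho (wB _ (leqnn T)).
- move=> v b vB bB bv.
  (* A vertex outside [B] is unvisited by time [T], so its rotor is still the initial one. *)
  have -> : rho v = r v.
    rewrite /rho rotor_iter [visits _ _ _ _](_ : _ = 0) //; apply/eqP.
    rewrite -leqn0 leqNgt; apply/negP => /visits_gt0P[t tT E].
    by move: vB; rewrite -E wB // ltnW.
  apply: reflect; first by rewrite -[adj _ _]/(_ \in adj v) -(hm v).2.
  by move: vB bB; rewrite !inE -ltnNge => /[swap]; exact: leq_ltn_trans.
(* Height above [K.+1] keeps the neighbours outside [B] too. *)
- have [n hn] := hexit rho (rotor_walk m r x T) K.+1 hrho; exists n.
  split=> [|b]; first by rewrite inE -ltnNge ltnW.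
  rewrite (hm _).2 => ab; rewrite inE -ltnNge -ltnS (leq_trans hn) //.
  by apply: hstep; rewrite adjC.
have path_v : rotor_path B rho (rotor_walk m r x T) (rotor_walk m r x s).
  apply: visited_rotor_path => [t tT|]; first exact/wB/ltnW.
  exact: leq_maxl.
have [_ /(_ u uv)[k wk]] := tour_n _ path_v.
exists (T + k); rewrite rotor_walkD; split=> //.
by rewrite (leq_trans (leq_maxr s N)) // leq_addr.
Qed.

End RotorWalk.

(** * Lattice geometry and the sup norm *)

Section Lattice.

Import GRing.Theory Num.Theory.
Local Open Scope ring_scope.

Variable d : nat.

Implicit Types x y : 'rV[int]_d.

Definition sup_norm x : nat := \max_(i < d) `|x ord0 i|%N.

Lemma sup_norm_leP x k :
  reflect (forall i, (`|x ord0 i| <= k)%N) (sup_norm x <= k)%N.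
Proof.
apply: (iffP (bigmax_leqP _ _ _)) => h i; [exact: h | by move=> _; exact: h].
Qed.

Lemma Zd_adjC : symmetric (@Zd_adj d).
Proof.
move=> x y; rewrite /Zd_adj; congr (_ == _).
by apply: eq_bigr => i _; rewrite -sqrrN opprB.
Qed.

Lemma Zd_adjP x y : reflect
  (exists2 i, `|x ord0 i - y ord0 i|%N = 1%N &
    forall j, j != i -> x ord0 j = y ord0 j) (Zd_adj x y).
Proof.
have -> : Zd_adj x y = (\sum_(i < d) `|(x ord0 i - y ord0 i)%R| ^ 2 == 1)%N.
  rewrite /Zd_adj -eqz_nat -[X in _ = (X == _)]intz sumMz.
  congr (_ == _); apply: eq_bigr => i _.
  by rewrite intz -abszX; case: (_ ^+ 2) (sqr_ge0 (x ord0 i - y ord0 i)).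
apply: (iffP (@sum_nat_eq1 _ _ _)) => [[i [_ hi hj]]|[i hi hj]]; exists i.
  by apply/eqP; rewrite -(eqn_exp2r _ _ (isT : 0 < 2)%N) hi.
- by move=> j /hj/(_ isT)/eqP; rewrite expn_eq0 andbT => /eqP; lia.
- by split=> [//||j /hj -> _]; rewrite ?hi // subrr.
Qed.

Lemma Zd_adj_coord x y i : Zd_adj x y -> (`|x ord0 i - y ord0 i| <= 1)%N.
Proof.
case/Zd_adjP => j hj hi; case: (eqVneq i j) => [->|/hi ->]; first by rewrite hj.
by rewrite subrr.
Qed.

Lemma sup_norm_adj x y : Zd_adj x y -> (sup_norm y <= (sup_norm x).+1)%N.
Proof.
move=> a; apply/sup_norm_leP => i; have := Zd_adj_coord i a.
by have /sup_norm_leP/(_ i) := leqnn (sup_norm x); lia.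
Qed.

(* Decreasing the sup norm means moving along the only coordinate attaining
   it, if there is just one. *)
Lemma sup_norm_decr_unique x y z :
  Zd_adj x y -> Zd_adj x z -> (sup_norm y < sup_norm x)%N ->
  (sup_norm z < sup_norm x)%N -> y = z.
Proof.
move=> axy axz ly lz.
have : ~~ (sup_norm x <= maxn (sup_norm y) (sup_norm z))%N.
  by rewrite -ltnNge gtn_max ly.
move=> /sup_norm_leP nle.
suff E j : y ord0 j = z ord0 j by apply/rowP.
case: (pickP (fun i => maxn (sup_norm y) (sup_norm z) < `|x ord0 i|)%N)
  => [i|no]; last first.
  by case: nle => i; rewrite leqNgt no.
have /sup_norm_leP/(_ i) hy := leq_maxl (sup_norm y) (sup_norm z).
have /sup_norm_leP/(_ i) hz := leq_maxr (sup_norm y) (sup_norm z).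
case/Zd_adjP: axy axz => i1 y1 hi1 /Zd_adjP[i2 z2 hi2] hx.
have E1 : i1 = i by apply/eqP/negPn/negP; rewrite eq_sym => /hi1; lia.
have E2 : i2 = i by apply/eqP/negPn/negP; rewrite eq_sym => /hi2; lia.
subst i1 i2; case: (eqVneq j i) => [->|ne]; first lia.
by rewrite -hi1 // hi2.
Qed.

Definition shift x (i : 'I_d) (a : int) : 'rV[int]_d :=
  \row_j (x ord0 j + a *+ (j == i)).

Lemma Zd_adj_shift x i a : `|a|%N = 1%N -> Zd_adj x (shift x i a).
Proof.
move=> ha; apply/Zd_adjP; exists i => [|j ne]; rewrite mxE ?eqxx; first lia.
by rewrite (negPf ne) mulr0n addr0.
Qed.

Lemma Zd_connected (P : 'rV[int]_d -> Prop) x :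
  P x -> (forall u v, P u -> Zd_adj u v -> P v) -> forall y, P y.
Proof.
move=> Px hP y.
(* Induction on the l1 distance from [x] to [y]. *)
have [n] := ubnP (\sum_(i < d) `|(y ord0 i - x ord0 i)%R|)%N.
elim: n y => [//|n IH] y hn.
case: (pickP (fun i => y ord0 i != x ord0 i)) => [i hi|hx]; last first.
  suff -> : y = x by [].
  by apply/rowP => i; exact/eqP/negPn/negbT/hx.
pose a : int := if (x ord0 i <= y ord0 i)%R then -1 else 1.
have ha : `|a|%N = 1%N by rewrite /a; case: ifP.
apply: (hP (shift y i a)); last by rewrite Zd_adjC Zd_adj_shift.
apply: IH; rewrite -ltnS (leq_trans _ hn) // !ltnS.
rewrite [ltnRHS](bigD1 i) // [ltnLHS](bigD1 i) //=.
rewrite -addSn leq_add //; last first.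
  by apply: leq_sum => j ne; rewrite mxE (negPf ne) mulr0n addr0.
by rewrite mxE eqxx mulr1n /a; case: ifP; lia.
Qed.

Lemma sup_norm_finite k :
  exists s : seq 'rV[int]_d, forall x, (sup_norm x <= k)%N -> x \in s.
Proof.
exists [seq \row_i ((f i)%:Z - k%:Z) | f : {ffun 'I_d -> 'I_(k + k).+1}].
move=> x /sup_norm_leP hx; apply/mapP.
exists [ffun i => inord `|x ord0 i + k%:Z|]; first by rewrite mem_enum.
apply/rowP => i; rewrite mxE ffunE; transitivity (x ord0 i) => //.
by move: (hx i) => hi; rewrite inordK; lia.
Qed.

Lemma unbounded_walk m rho y k : (0 < d)%N ->
    rotor_mechanism (@Zd_adj d) m -> rotor_config (@Zd_adj d) rho ->
  exists n, (k < sup_norm (rotor_walk m rho y n))%N.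
Proof.
move=> d0 hm hrho; pose w := rotor_walk m rho y.
apply: Classical_Prop.NNPP => nex.
have conf n : (sup_norm (w n) <= k)%N.
  by rewrite leqNgt; apply/negP => lt; apply: nex; exists n.
pose e := Ordinal d0.
(* Vertices with coordinate [e] above [k] are never visited; bounds on visits pass back from them
   along that axis. *)
have bnd : forall x, exists C, forall n, (visits m rho y n x <= C)%N.
  move=> x; have [j] := ubnP `|(k%:Z + 1 - x ord0 e)%R|%N.
  elim: j x => [//|j IH] x hj.
  case: (lerP (x ord0 e) k%:Z) => hx; last first.
    exists 0%N => n; rewrite leqNgt; apply/negP.
    move=> /visits_gt0P[s _ E]; have := conf s.
    by rewrite /w E => /sup_norm_leP/(_ e); lia.
  have [|C hC] := IH (shift x e 1); first by rewrite mxE eqxx mulr1n; lia.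
  apply: (visits_neighbour_bounded Zd_adjC hm hrho _ hC).
  by rewrite (hm x).2; exact: Zd_adj_shift.
have [s hs] := sup_norm_finite k.
have [C hC] : exists C, forall n, (\sum_(x <- s) visits m rho y n x <= C)%N.
  elim: s {hs} => [|x s [C hC]]; first by exists 0%N => n; rewrite big_nil.
  by have [D hD] := bnd x; exists (D + C)%N => n; rewrite big_cons leq_add.
(* The first [C.+1] positions all lie in [s], whose total number of visits is at most [C]. *)
have := hC C.+1; rewrite leqNgt => /negP; apply.
rewrite /visits exchange_big /= -[X in (X <= _)%N]card_ord -sum1_card.
apply: leq_sum => t _; rewrite (big_rem (w t)) ?hs //=.
by rewrite -/(w t) eqxx.
Qed.

End Lattice.

Theorem theorem2 (d : nat) (hd : (1 <= d)%N)
    (m : 'rV[int]_d -> seq 'rV[int]_d)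
    (hm : rotor_mechanism (@Zd_adj d) m) :
  exists r : 'rV[int]_d -> 'rV[int]_d,
    rotor_config (@Zd_adj d) r /\ recurrent_config m r.
Proof.
(* The default is the first neighbour, used when none has smaller norm; the inner default [u] never
   occurs. *)
pose inner u := nth (nth u (m u) 0) [seq v <- m u | sup_norm v < sup_norm u] 0.
have inner_mem u : inner u \in m u.
  rewrite /inner; case E : [seq v <- _ | _] => [|v s] /=.
    apply: mem_nth; rewrite -has_predT; apply/hasP.
    exists (shift u (Ordinal hd) 1%R); rewrite // (hm u).2.
    exact: Zd_adj_shift.
  have : v \in [seq v <- m u | sup_norm v < sup_norm u] by rewrite E mem_head.
  by rewrite mem_filter => /andP[].
have inner_eq u b : Zd_adj u b -> sup_norm b < sup_norm u -> inner u = b.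
  move=> ub lb; have : b \in [seq v <- m u | sup_norm v < sup_norm u].
    by rewrite mem_filter lb (hm u).2.
  rewrite /inner; case E : [seq v <- _ | _] => [//|v s] _ /=.
  have : v \in [seq v <- m u | sup_norm v < sup_norm u] by rewrite E mem_head.
  rewrite mem_filter (hm u).2 => /andP[lv uv].
  exact: sup_norm_decr_unique uv ub lv lb.
(* One place before [inner u], because the rotor is incremented before the first exit. *)
pose r u := prev (m u) (inner u).
have hr : rotor_config (@Zd_adj d) r.
  by move=> u; rewrite -[Zd_adj _ _]/(_ \in Zd_adj u) -(hm u).2 mem_prev.
exists r; split=> // x.
have revisit s u N : Zd_adj (rotor_walk m r x s) u ->
    exists n, N <= n /\ rotor_walk m r x n = u.
  move=> a.
  apply: (@revisit_neighbours _ _ m (@Zd_adjC d) hm (@sup_norm d) r x hr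
            _ _ _ s).
  - exact: sup_norm_adj.
  - by move=> v b vb lb; rewrite /r next_prev ?(hm v).1 //; exact: inner_eq.
  - by move=> rho y k; exact: unbounded_walk.
  - by rewrite (hm _).2.
have visited : forall v, exists s, rotor_walk m r x s = v.
  apply: (Zd_connected (x := x)); first by exists 0.
  by move=> u v [s <-] /(revisit s v 0)[n [_ <-]]; exists n.
(* Any neighbour of [v] would do: once it is visited, [v] is visited after time [N]. *)
move=> v N; have [s ws] := visited (inner v).
apply: (revisit s); rewrite ws Zd_adjC.
by rewrite -[Zd_adj _ _]/(_ \in Zd_adj v) -(hm v).2.
Qed.
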